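(* For every finite undirected graph $G$, $$i_g(G) \le \left\lfloor\frac{3\Delta(G) - a(G)}{2}\right\rfloor + 8a(G) - 1,$$ where $\Delta(G)$ is the maximum degree of $G$, $a(G)$ is the arboricity of $G$, and $i_g(G)$ is the incidence game chromatic number of $G$.
   Context: An incidence of a graph $G$ is a pair $(v,e)$ where $v$ is a vertex of $G$ and $e$ is an edge of $G$ incident to $v$. Two incidences $(v,e)$ and $(w,f)$ are adjacent if $v=w$, or $e=f$, or the edge $vw$ equals $e$ or $f$. An incidence coloring assigns colors to incidences so that adjacent incidences get distinct colors. The incidence coloring game on $G$ with a given set of $k$ colors: two players, Alice and Bob, alternately color an uncolored incidence of $G$ (Alice moves first) with one of the $k$ colors, so that the partial coloring always remains a proper incidence coloring. Alice wins if eventually all incidences of $G$ are colored; otherwise (i.e. if at some point some uncolored incidence has no legal color) Bob wins. The incidence game chromatic number $i_g(G)$ is the smallest $k$ for which Alice has a winning strategy. The arboricity $a(G)$ is the minimum number of forests into which the edge set of $G$ can be partitioned.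
   Formalization: For graphs without edges, where arboricity and maximum degree are 0 and the stated bound would be −1 while the incidence game chromatic number is 0, the bound is replaced by 0; for every graph with at least one edge the bound is as stated. *)

(* Defs.v *)
From mathcomp Require Import all_boot.
Set Implicit Arguments. Unset Strict Implicit. Unset Printing Implicit Defensive.

(* A finite simple undirected graph is given by a finType V of vertices and
   a symmetric irreflexive relation adj on V.  Edges are 2-element sets. *)

Section Graph.
Variables (V : finType) (adj : rel V).

Definition edges : {set {set V}} := [set e | [exists v, exists w, adj v w && (e == [set v; w])]].

Definition max_degree : nat := \max_(v : V) #|[set w | adj v w]|.

Definition acyclic (F : {set {set V}}) : Prop :=
  forall s : seq V, uniq s -> 3 <= size s ->
    ~~ cycle (fun x y => [set x; y] \in F) s.

Definition forest_decomposition (k : nat) : Prop :=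
  exists F : 'I_k -> {set {set V}},
    [/\ forall i, acyclic (F i),
        forall i j, i != j -> [disjoint F i & F j]
      & \bigcup_(i < k) F i = edges].

Definition arboricity (a : nat) : Prop :=
  forest_decomposition a /\ forall j, j < a -> ~ forest_decomposition j.

Definition incidenceb (x : V * {set V}) : bool :=
  [exists w, adj x.1 w && (x.2 == [set x.1; w])].

Definition incidence := {x : V * {set V} | incidenceb x}.

Definition inc_adj (x y : V * {set V}) : bool :=
  [|| x.1 == y.1, x.2 == y.2, [set x.1; y.1] == x.2 | [set x.1; y.1] == y.2].

Section Game.
Variable k : nat.

Definition state := {ffun incidence -> option 'I_k}.

Definition empty_state : state := [ffun => None].

Definition all_colored (c : state) : Prop := forall x, c x <> None.

Definition legal_move (c : state) (x : incidence) (a : 'I_k) : Prop :=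
  c x = None /\
  forall y : incidence, y != x -> inc_adj (val x) (val y) -> c y <> Some a.

Definition play (c : state) (x : incidence) (a : 'I_k) : state :=
  [ffun y => if y == x then Some a else c y].

(* some uncolored incidence has no legal color: Bob has won *)
Definition stuck (c : state) : Prop :=
  exists x, c x = None /\ forall a, ~ legal_move c x a.

(* alice_wins b c : from position c with Alice to move (b = true) or Bob to
   move (b = false), Alice has a winning strategy. *)
Inductive alice_wins : bool -> state -> Prop :=
| AW_done b c : all_colored c -> alice_wins b c
| AW_alice c x a : ~ stuck c -> legal_move c x a ->
    alice_wins false (play c x a) -> alice_wins true c
| AW_bob c : ~ stuck c ->
    (forall x a, legal_move c x a -> alice_wins true (play c x a)) ->
    alice_wins false c.

Definition alice_wins_game : Prop := alice_wins true empty_state.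

End Game.
End Graph.

(* Main.v *)
Require Import Defs.
From mathcomp Require Import all_boot zify.
Set Implicit Arguments. Unset Strict Implicit. Unset Printing Implicit Defensive.

(* Read the incidence (v, vw) as the arc from v to w: two arcs conflict when they
   have the same tail or are consecutive.  Arcs with a common head do not
   conflict, so Alice can save colors among the arcs entering a vertex.

   Rooting the trees of the a forests gives each vertex at most a fathers.  When
   Bob colors an arc between v and a son of v, Alice walks from v towards
   fathers: at each vertex she takes an uncolored arc joining it to a father,
   preferably one leaving the father; if it was never touched she touches it and
   moves on to that father, otherwise she colors it.  Hence a vertex with
   uncolored arcs to its fathers has O(a) colored arcs to its sons.  If the walk
   reaches a vertex all of whose father arcs are colored, she repeats a color
   already present among the arcs entering it from its sons; this fails only if
   few colors are present there.  So these arcs use at most half of their number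
   plus O(a) colors, and an uncolored arc never meets all the colors. *)

(** * Orienting the edges of [a] forests with at most [a] fathers per vertex *)

(** If every vertex of [S] had two neighbors in [S], a path could be prolonged forever at its first
    vertex: a neighbor of it already on the path, other than the second vertex, would close a
    cycle. *)
Lemma acyclic_leaf (V : finType) (F : {set {set V}}) (S : {set V}) :
  acyclic F -> S != set0 ->
  exists2 x, x \in S & #|[set y in S | (y != x) && ([set x; y] \in F)]| <= 1.
Proof.
move=> acF /set0Pn [x0 x0S].
pose N x := [set y in S | (y != x) && ([set x; y] \in F)].
have [/existsP [x /andP [xS Nx]]|noleaf] := boolP [exists x, (x \in S) && (#|N x| <= 1)].
  by exists x.
have deg2 x : x \in S -> 1 < #|N x|.
  move=> xS; rewrite ltnNge; apply: contra noleaf => Nx.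
  by apply/existsP; exists x; rewrite xS.
pose e x y := [set x; y] \in F.
have longpath n : exists x p,
    [/\ size p = n, uniq (x :: p), all (mem S) (x :: p) & path e x p].
  elim: n => [|n [x [p [szp up /= /andP [xS pS] ep]]]].
    by exists x0, [::]; split=> //=; rewrite x0S.
  have [/existsP [y /andP [yN yp]]|closed] :=
      boolP [exists y, (y \in N x) && (y \notin x :: p)].
    move: yN; rewrite inE => /and3P [yS nyx yxF].
    exists y, (x :: p); split=> //=; first by rewrite szp.
    - by rewrite yp.
    - by rewrite yS xS.
    - by rewrite ep andbT /e setUC.
  (* Avoiding the second vertex of the path gives the cycle at least 3 vertices. *)
  have [y yN yh] : exists2 y, y \in N x & y != head x p.
    have : 0 < #|N x :\ head x p|.
      by have := deg2 _ xS; rewrite (cardsD1 (head x p) (N x)); case: (_ \in _); lia.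
    by case/card_gt0P => y; rewrite in_setD1 => /andP [? ?]; exists y.
  have yp : y \in p.
    move: closed; rewrite negb_exists => /forallP /(_ y).
    rewrite yN /= negbK inE; case/orP => // /eqP yx.
    by move: yN; rewrite inE yx eqxx andbF.
  move: yN; rewrite inE => /and3P [yS nyx yxF].
  case/splitPr: yp szp up pS ep yh => p1 p2 _ up _ ep yh.
  have := acF (x :: rcons p1 y).
  have -> : uniq (x :: rcons p1 y).
    by move: up; rewrite -cat_rcons -cat_cons cat_uniq => /and3P [].
  have -> : 3 <= size (x :: rcons p1 y).
    by rewrite /= size_rcons; case: p1 yh {up ep} => [/=|//]; rewrite eqxx.
  move=> /(_ isT isT) /negP []; rewrite /= rcons_path last_rcons.
  move: ep; rewrite -cat_rcons cat_path => /andP [-> _] /=.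
  by rewrite setUC.
have [x [p [szp up _ _]]] := longpath #|V|.
by have := max_card (mem (x :: p)); rewrite (card_uniqP up) /= szp ltnn.
Qed.

(** Induction on [S]: remove a leaf, whose only possible neighbor in [S] becomes its parent. *)
Lemma acyclic_parent (V : finType) (F : {set {set V}}) :
  acyclic F ->
  exists par : {ffun V -> option V}, forall u v,
    u != v -> [set u; v] \in F -> (par u == Some v) || (par v == Some u).
Proof.
move=> acF.
suff H n : forall S : {set V}, #|S| = n ->
    exists par : {ffun V -> option V}, forall u v, u \in S -> v \in S ->
    u != v -> [set u; v] \in F -> (par u == Some v) || (par v == Some u).
  have [par Hpar] := H _ setT erefl.
  by exists par => u v; apply: Hpar; rewrite inE.
elim: n => [|n IH] S cS.
  by exists [ffun=> None] => u v; rewrite (cards0_eq cS) inE.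
have [|x xS lx] := @acyclic_leaf _ F S acF; first by rewrite -card_gt0 cS.
have [|par Hpar] := IH (S :\ x).
  by move: cS; rewrite (cardsD1 x) xS => - [].
pose N := [set y in S | (y != x) && ([set x; y] \in F)].
exists [ffun u => if u == x then [pick y in N] else par u] => u v uS vS uv uvF.
have pickx w : w \in S -> w != x -> [set x; w] \in F -> [pick y in N] = Some w.
  move=> wS wx wF; have wN : w \in N by rewrite inE wS wx.
  case: pickP => [y yN|/(_ w)]; last by rewrite wN.
  by congr Some; apply: (card_le1_eqP lx).
rewrite !ffunE; case: (eqVneq u x) => [ux|ux].
  by rewrite (pickx v) ?eqxx -?ux // eq_sym.
case: (eqVneq v x) => [vx|vx]; last by apply: Hpar; rewrite ?in_setD1 ?ux ?vx.
by rewrite (pickx u) ?eqxx ?orbT // -vx setUC.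
Qed.

Lemma forest_orientation (V : finType) (adj : rel V) (a : nat) :
  symmetric adj -> irreflexive adj -> forest_decomposition adj a ->
  exists2 up : rel V, forall u v, adj u v -> up u v = ~~ up v u
    & forall v, #|[set w | up v w]| <= a.
Proof.
move=> sym irr [F [acF _ covF]].
have [par Hpar] := fin_all_exists (fun i => acyclic_parent (acF i)).
pose up0 u v := adj u v && [exists i, par i u == Some v].
have up0_total u v : adj u v -> up0 u v || up0 v u.
  move=> uv; rewrite /up0 -(sym u v) uv /=.
  have : [set u; v] \in edges adj.
    by rewrite inE; apply/existsP; exists u; apply/existsP; exists v; rewrite uv eqxx.
  rewrite -covF => /bigcupP [i _ uvF].
  have nuv : u != v by apply: contraTneq uv => ->; rewrite irr.
  by case/orP: (Hpar i u v nuv uvF) => H; apply/orP; [left|right];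
    apply/existsP; exists i.
(* Two adjacent vertices may each be a parent of the other; the enumeration rank then decides. *)
exists (fun u v => up0 u v && (up0 v u ==> (enum_rank u < enum_rank v))).
- move=> u v uv; have nuv : u != v by apply: contraTneq uv => ->; rewrite irr.
  have : enum_rank u != enum_rank v :> nat by rewrite (inj_eq val_inj) (inj_eq enum_rank_inj).
  by case/orP: (up0_total _ _ uv) => -> /=; case: (up0 _ _) => //=;
    case: ltngtP.
- move=> v; rewrite -[leqRHS]card_ord.
  apply: leq_trans (leq_imset_card (fun i => odflt v (par i v)) 'I_a).
  apply: subset_leq_card; apply/subsetP => w; rewrite inE.
  case/andP => /andP [_ /existsP [i /eqP Hi]] _.
  by apply/imsetP; exists i; rewrite ?Hi.
Qed.

(** * Sons, fathers and the arcs between them *)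

Section Strategy.
Variables (V arc : finType) (tl hd : arc -> V) (top : pred arc) (D a k : nat).

Definition clash x y := [|| tl x == tl y, hd x == tl y | tl x == hd y].
Definition outs v := [set x | tl x == v].
Definition ins v := [set x | hd x == v].

(* Every edge joins a son to a father; of its two arcs, the top one leaves the
   father and the down one leaves the son. *)
Definition son x := if top x then hd x else tl x.
Definition father x := if top x then tl x else hd x.

Definition son_arcs v := [set x | father x == v].
Definition father_arcs v := [set x | son x == v].
Definition top_father v := [set x | top x && (son x == v)].
Definition down_father v := [set x | ~~ top x && (son x == v)].
Definition top_son v := [set x | top x && (father x == v)].
Definition down_son v := [set x | ~~ top x && (father x == v)].

Hypothesis tl_neq_hd : forall x, tl x != hd x.
Hypothesis card_outs : forall v, #|outs v| <= D.
Hypothesis card_ins : forall v, #|ins v| <= D.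
Hypothesis card_top_father : forall v, #|top_father v| <= a.
Hypothesis card_down_father : forall v, #|down_father v| <= a.
Hypothesis reverse_exists : forall x, top x ->
  exists2 y, y \in down_father (son x) & y \in down_son (father x).

Lemma clash_sym : symmetric clash.
Proof.
by move=> x y; rewrite /clash ![tl y == _]eq_sym [hd y == _]eq_sym;
  congr (_ || _); rewrite orbC.
Qed.

Lemma son_neq_father x : son x != father x.
Proof. by rewrite /son /father; case: (top x); rewrite ?tl_neq_hd // eq_sym tl_neq_hd. Qed.

(** Both kinds of arcs enter [v]. The joint bound saves one [a] in [card_forbidden_top] over the
    separate bounds [a] and [D]. *)
Lemma card_ins_split v : #|top_father v| + #|down_son v| <= D.
Proof.
apply: leq_trans (card_ins v).
rewrite -cardsUI [X in _ + X]eq_card0 ?addn0; last first.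
  by move=> x; rewrite !inE; case: (top x); rewrite ?andbF.
apply: subset_leq_card; apply/subsetP => x; rewrite !inE /son /father.
by case: (top x) => /=; rewrite ?orbF.
Qed.

Lemma card_father_arcs v : #|father_arcs v| <= a + a.
Proof.
apply: leq_trans (leq_add (card_top_father v) (card_down_father v)).
rewrite -cardsUI; apply: leq_trans (leq_addr _ _).
by apply: subset_leq_card; apply/subsetP => x; rewrite !inE; case: (top x); rewrite /= ?orbF.
Qed.

(** * Partial colorings *)

Notation state := {ffun arc -> option 'I_k}.
Implicit Types (c : state) (x y z : arc) (A K M : {set arc}) (v w : V) (b : 'I_k).

Definition color c x b : state := [ffun y => if y == x then Some b else c y].
Definition colored c := [set x | c x != None].
Definition colors c A := [set b | [exists x, (x \in A) && (c x == Some b)]].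
Definition forbidden c x :=
  [set b | [exists y, [&& y != x, clash x y & c y == Some b]]].
Definition proper c := forall x y b,
  y != x -> clash x y -> c x = Some b -> c y <> Some b.

Lemma uncolored c x : c x = None -> x \notin colored c.
Proof. by rewrite inE => ->. Qed.

Lemma card_colors_colored c A : #|colors c A| <= #|colored c :&: A|.
Proof.
have Some_inj : injective (@Some 'I_k) by move=> b d [].
rewrite -(card_imset _ Some_inj).
apply: leq_trans (leq_imset_card c _); apply: subset_leq_card.
apply/subsetP => _ /imsetP [b + ->]; rewrite inE => /existsP [x /andP [xA /eqP cx]].
by apply/imsetP; exists x; rewrite // !inE cx xA.
Qed.

Lemma card_colors c A : #|colors c A| <= #|A|.
Proof.
by apply: leq_trans (card_colors_colored c A) (subset_leq_card (subsetIr _ _)).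
Qed.

Lemma card_colorsU c A K : #|colors c (A :|: K)| <= #|colors c A| + #|colors c K|.
Proof.
rewrite -cardsUI; apply: leq_trans (leq_addr _ _); apply: subset_leq_card.
apply/subsetP => b; rewrite !inE => /existsP [x /andP []]; rewrite inE.
by move=> /orP [] xA cx; apply/orP; [left|right]; apply/existsP; exists x; rewrite xA.
Qed.

Lemma forbidden_sub c x A :
  (forall y, y != x -> clash x y -> y \in A) -> forbidden c x \subset colors c A.
Proof.
move=> clashA; apply/subsetP => b; rewrite !inE.
case/existsP => y /and3P [yx xy cy]; apply/existsP; exists y.
by rewrite cy clashA.
Qed.

Definition legal c x b := c x = None /\ b \notin forbidden c x.

Lemma proper_color c x b : proper c -> legal c x b -> proper (color c x b).
Proof.
move=> pc [cx ok].
have fresh y : y != x -> clash x y -> c y <> Some b.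
  move=> yx xy cy; case/negP: ok; rewrite inE; apply/existsP; exists y.
  by rewrite yx xy cy eqxx.
move=> y z d; rewrite !ffunE; have [->|yx] := eqVneq y x.
  by move=> zx xz [<-]; rewrite (negPf zx); apply: fresh.
have [-> _|zx zy] := eqVneq z x; last exact: pc.
by rewrite clash_sym => xy cy [bd]; apply: (fresh y); rewrite // bd.
Qed.

Lemma colored_color c x b : colored (color c x b) = x |: colored c.
Proof. by apply/setP => y; rewrite !inE ffunE; case: (y == x). Qed.

Lemma colors_color c x b A : c x = None ->
  colors (color c x b) A = if x \in A then b |: colors c A else colors c A.
Proof.
move=> cx; apply/setP => d; case: ifP => xA; rewrite !inE.
  apply/existsP/orP => [[y]|[/eqP ->|/existsP [y]]].
  - rewrite ffunE; have [_ /andP [_ /eqP [->]]|_ yd] := eqVneq y x; first by left.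
    by right; apply/existsP; exists y.
  - by exists x; rewrite xA ffunE !eqxx.
  - case/andP=> yA /eqP cy; exists y; rewrite yA ffunE cy.
    by have [yx|_] := eqVneq y x; rewrite ?eqxx //; move: cy; rewrite yx cx.
by apply/existsP/existsP => - [y /andP [yA cy]]; exists y; rewrite yA /=;
  move: cy; rewrite ffunE; have [yx|//] := eqVneq y x; move: yA; rewrite yx xA.
Qed.

(** * The invariant and its upkeep *)

Lemma card_setU1I x M A :
  #|(x |: M) :&: A| = ((x \in A) && (x \notin M)) + #|M :&: A|.
Proof.
rewrite setIUl; case: (boolP (x \in A)) => xA /=.
  by rewrite (setIidPl _) ?sub1set // cardsU1 inE xA andbT.
rewrite (_ : [set x] :&: A = set0) ?set0U //.
by apply/eqP; rewrite setI_eq0 disjoints1.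
Qed.

Lemma card_colored_lt c x A : x \in A -> c x = None -> #|colored c :&: A| < #|A|.
Proof.
move=> xA cx; apply: proper_card; rewrite properE subsetIr.
by apply/subsetPn; exists x; rewrite // !inE cx.
Qed.

(* [K] is meant to be the set of colored arcs, [M] the set of touched ones and
   [A] a set of arcs joining [v] to its fathers.  While [A] is not entirely
   colored, every touching of an arc of [son_arcs v] is paid for by a touching
   or a coloring in [A]; [e] allows a debt of one. *)
Definition quota A K M (e : bool) v := ~~ (A \subset K) ==>
  (#|M :&: son_arcs v| <= #|M :&: A| + #|K :&: A| + e).

(* Past a constant, at most every other coloring in [down_son v] brings a new
   color.  The constant [6 * a] exceeds the number of colored arcs around a
   vertex that still has an uncolored father arc, see [card_colors_around]. *)
Definition few_colors c (e : bool) v :=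
  2 * #|colors c (down_son v)| <=
  #|colored c :&: down_son v| + 6 * a + (e || (down_son v \subset colored c)).

Definition vertex_inv c M e v :=
  [/\ quota (top_father v) (colored c) M e v,
      quota (father_arcs v) (colored c) M e v & few_colors c e v].

Definition state_inv c M (e : pred V) :=
  [/\ proper c, colored c \subset M & forall v, vertex_inv c M (e v) v].

(** Here [s] counts the newly touched son arcs, [p] and [q] the newly touched and newly colored arcs
    of [A]. If [A] is unfinished after the step, it was so before. *)
Lemma quota_step A K K' M M' (e e' : bool) v s p q :
  #|M' :&: son_arcs v| = s + #|M :&: son_arcs v| ->
  #|M' :&: A| = p + #|M :&: A| -> #|K' :&: A| = q + #|K :&: A| ->
  K \subset K' -> s + e <= p + q + e' ->
  quota A K M e v -> quota A K' M' e' v.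
Proof.
move=> eqS eqM eqK KK' le /implyP Q; apply/implyP => nAK'.
have /Q : ~~ (A \subset K) by apply: contra nAK' => AK; apply: subset_trans KK'.
by rewrite eqS eqM eqK; move: le; clear; lia.
Qed.

Lemma quota_done A K M e v : A \subset K -> quota A K M e v.
Proof. by rewrite /quota => ->. Qed.

Lemma few_colors_small c e v : #|colors c (down_son v)| <= 6 * a -> few_colors c e v.
Proof.
by rewrite /few_colors; have := card_colors_colored c (down_son v); lia.
Qed.

Lemma state_inv_weaken c M (e e' : pred V) :
  (forall v, e v -> e' v) -> state_inv c M e -> state_inv c M e'.
Proof.
move=> ee' [pc KM inv]; split=> // v; have [q1 q2 f] := inv v.
have {}ee' : e v <= e' v by case: (e v) (ee' v) => // ->.
have keep n : n = 0 + n by [].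
split; [exact: quota_step (keep _) (keep _) (keep _) _ ee' q1
       |exact: quota_step (keep _) (keep _) (keep _) _ ee' q2|].
by apply: leq_trans f _; rewrite leq_add2l; case: (e v) ee'; case: (e' v); case: (_ \subset _).
Qed.

Lemma state_inv_empty : state_inv ([ffun=> None] : state) set0 pred0.
Proof.
have E : colored ([ffun=> None] : state) = set0.
  by apply/setP => x; rewrite !inE ffunE.
split; first by move=> x y b _ _; rewrite ffunE.
  by rewrite E.
move=> v; split; [by rewrite /quota set0I cards0 implybT..|].
apply: few_colors_small; apply: leq_trans (card_colors_colored _ _) _.
by rewrite E set0I cards0.
Qed.

Lemma few_colors_notin c x b e v : c x = None -> x \notin down_son v ->
  few_colors c e v -> few_colors (color c x b) e v.
Proof.
move=> cx xv; rewrite /few_colors colors_color // (negPf xv) colored_color.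
rewrite card_setU1I (negPf xv) /= => /leq_trans; apply; rewrite leq_add2l.
case: e => //=; case: (boolP (_ \subset colored c)) => //= sub.
by rewrite (subset_trans sub) // subsetUr.
Qed.

(** A new color adds 2 on the left; the newly colored arc and the debt add 1 each on the right. The
    subset term was 0 if [x] lies in [down_son v]. *)
Lemma few_colors_new c x b v : c x = None ->
  few_colors c false v -> few_colors (color c x b) true v.
Proof.
move=> cx f; case: (boolP (x \in down_son v)) => xv; last first.
  apply: few_colors_notin => //; apply: leq_trans f _.
  by rewrite leq_add2l leq_b1.
move: f; rewrite /few_colors colors_color // xv colored_color card_setU1I xv.
rewrite uncolored //= cardsU1 [_ \subset colored c](_ : _ = false).
  by case: (_ \notin _) => /=; lia.
by apply/negbTE/subsetPn; exists x; rewrite ?uncolored.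
Qed.

(** The left side is unchanged, and the newly colored arc makes up for the debt. *)
Lemma few_colors_reuse c x b e v : c x = None -> x \in down_son v ->
  b \in colors c (down_son v) -> few_colors c e v -> few_colors (color c x b) false v.
Proof.
move=> cx xv bv; rewrite /few_colors colors_color // xv colored_color card_setU1I xv.
rewrite uncolored //= [b |: _](setUidPr _) ?sub1set //.
by case: (_ || _); case: (_ \subset _) => /=; lia.
Qed.

(** Only [father x] can go into debt, since [x] is a son arc of no other vertex. *)
Lemma bob_move c M x b : state_inv c M pred0 -> legal c x b ->
  state_inv (color c x b) (x |: M) (pred1 (father x)).
Proof.
move=> [pc KM inv] ok; have [cx _] := ok.
split; first exact: proper_color.
  by rewrite colored_color setUS.
move=> v; have [q1 q2 f] := inv v; rewrite /= eq_sym in q1 q2 f *.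
have xS : (x \in son_arcs v) && (x \notin M) <= (father x == v).
  by rewrite inE; case: (father x == v); rewrite ?leq_b1.
split.
- rewrite colored_color.
  apply: quota_step (card_setU1I _ _ _) (card_setU1I _ _ _) (card_setU1I _ _ _)
    (subsetUr _ _) _ q1.
  by rewrite addn0 (leq_trans xS) ?leq_addl.
- rewrite colored_color.
  apply: quota_step (card_setU1I _ _ _) (card_setU1I _ _ _) (card_setU1I _ _ _)
    (subsetUr _ _) _ q2.
  by rewrite addn0 (leq_trans xS) ?leq_addl.
case: eqP => [_|/eqP xv]; first exact: few_colors_new.
by apply: few_colors_notin => //; rewrite inE (negPf xv) andbF.
Qed.

(** * Counting the forbidden colors of an arc *)

(** By the quota: at most [a] top father arcs are touched, at most [a - 1] are colored because [x]
    is not, and the debt is at most 1. *)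
Lemma top_unfinished c M e x : state_inv c M e -> top x -> c x = None ->
  #|colored c :&: son_arcs (son x)| <= 2 * a.
Proof.
move=> [_ KM inv] tx cx; have [/implyP q _ _] := inv (son x).
have xT : x \in top_father (son x) by rewrite inE tx eqxx.
have /q : ~~ (top_father (son x) \subset colored c).
  by apply/subsetPn; exists x; rewrite ?uncolored.
have := card_colored_lt xT cx; have := card_top_father (son x).
have := subset_leq_card (subsetIr M (top_father (son x))).
have := subset_leq_card (setSI (son_arcs (son x)) KM).
by have := leq_b1 (e (son x)); lia.
Qed.

Lemma unfinished c M e x : state_inv c M e -> c x = None ->
  #|colored c :&: son_arcs (son x)| <= 4 * a /\
  #|colored c :&: father_arcs (son x)| <= (2 * a).-1.
Proof.
move=> [_ KM inv] cx; have [_ /implyP q _] := inv (son x).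
have xT : x \in father_arcs (son x) by rewrite inE.
have /q : ~~ (father_arcs (son x) \subset colored c).
  by apply/subsetPn; exists x; rewrite ?uncolored.
have := card_colored_lt xT cx; have := card_father_arcs (son x).
have := subset_leq_card (subsetIr M (father_arcs (son x))).
have := subset_leq_card (setSI (son_arcs (son x)) KM).
by have := leq_b1 (e (son x)); lia.
Qed.

Lemma down_tl x : ~~ top x -> tl x = son x.
Proof. by rewrite /son => /negPf ->. Qed.

Lemma down_hd x : ~~ top x -> hd x = father x.
Proof. by rewrite /father => /negPf ->. Qed.

Lemma top_tl x : top x -> tl x = father x.
Proof. by rewrite /father => ->. Qed.

Lemma top_hd x : top x -> hd x = son x.
Proof. by rewrite /son => ->. Qed.

Lemma around v y : (tl y == v) || (hd y == v) -> y \in son_arcs v :|: father_arcs v.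
Proof. by rewrite !inE /son /father; case: (top y) => //; rewrite orbC. Qed.

Hypothesis a_gt0 : 0 < a.

Lemma card_colors_around c M e x : state_inv c M e -> c x = None ->
  #|colors c (son_arcs (son x) :|: father_arcs (son x))| <= (6 * a).-1.
Proof.
move=> inv cx; have [] := unfinished inv cx.
have := card_colorsU c (son_arcs (son x)) (father_arcs (son x)).
have := card_colors_colored c (son_arcs (son x)).
have := card_colors_colored c (father_arcs (son x)).
lia.
Qed.

(** An arc clashing with [x] either meets [son x] or leaves [father x]. *)
Lemma card_forbidden_down c M e x : state_inv c M e -> c x = None -> ~~ top x ->
  #|forbidden c x| <= (6 * a).-1 + D.
Proof.
move=> inv cx dx.
have /subset_leq_card /leq_trans : forbidden c x \subset
    colors c ((son_arcs (son x) :|: father_arcs (son x)) :|: outs (father x)).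
  apply: forbidden_sub => y _; rewrite /clash in_setU.
  rewrite -(down_tl dx) -(down_hd dx) [y \in outs _]inE.
  case/or3P => [/eqP t|/eqP ->|/eqP h]; last 1 first.
  - by rewrite around // h eqxx orbT.
  - by rewrite around // t eqxx.
  - by rewrite eqxx orbT.
apply; apply: leq_trans (card_colorsU _ _ _) _; apply: leq_add.
  exact: card_colors_around inv cx.
exact: leq_trans (card_colors _ _) (card_outs _).
Qed.

(** In the doubled count, [outs] gives [2 * D - 2], [few_colors] gives at most
    [#|down_son| + 6 * a + 1], [top_unfinished] gives [4 * a], and the down arcs leaving the son
    give [2 * a - 2]. The top arcs entering the father count twice, once within [card_ins_split] and
    once as [a]. *)
Lemma card_forbidden_top c M e x : state_inv c M e -> c x = None -> top x ->
  2 * #|forbidden c x| + 3 <= 3 * D + 13 * a.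
Proof.
move=> inv cx tx; have [r rs rf] := reverse_exists tx.
have : forbidden c x \subset colors c ((outs (father x) :\ x) :|:
    (down_son (father x) :|: (top_father (father x) :|:
    (top_son (son x) :|: (down_father (son x) :\ r))))).
  apply: forbidden_sub => y yx; rewrite /clash (top_tl tx) (top_hd tx).
  (* The reverse [r] of [x] is already counted in [down_son (father x)]. *)
  have [->|yr] := eqVneq y r; first by rewrite !in_setU rf orbT.
  rewrite !in_setU !in_setD1 yx yr !inE.
  case ty: (top y); rewrite ?(top_tl ty) ?(top_hd ty).
    by case/or3P => /eqP ->; rewrite /= eqxx ?orbT.
  have dy := negbT ty; rewrite (down_tl dy) (down_hd dy).
  by case/or3P => /eqP ->; rewrite /= eqxx ?orbT.
move=> /subset_leq_card.
have := card_colorsU c (outs (father x) :\ x)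
  (down_son (father x) :|: (top_father (father x) :|:
    (top_son (son x) :|: (down_father (son x) :\ r)))).
have := card_colorsU c (down_son (father x)) (top_father (father x) :|:
    (top_son (son x) :|: (down_father (son x) :\ r))).
have := card_colorsU c (top_father (father x))
    (top_son (son x) :|: (down_father (son x) :\ r)).
have := card_colorsU c (top_son (son x)) (down_father (son x) :\ r).
have := card_colors c (outs (father x) :\ x).
have := card_colors c (top_father (father x)).
have := card_colors_colored c (top_son (son x)).
have := card_colors c (down_father (son x) :\ r).
have := cardsD1 x (outs (father x)); rewrite inE (top_tl tx) eqxx.
have := cardsD1 r (down_father (son x)); rewrite rs.
have := card_outs (father x).
have := card_down_father (son x).
have := card_top_father (father x).
have := card_ins_split (father x).
have : #|colored c :&: top_son (son x)| <= #|colored c :&: son_arcs (son x)|.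
  by apply/subset_leq_card/setIS/subsetP => y; rewrite !inE => /andP [].
have := top_unfinished inv tx cx.
have := subset_leq_card (subsetIr (colored c) (down_son (father x))).
have [_ _ /(_ (father x)) [_ _]] := inv; rewrite /few_colors.
by case: (_ || _) => /=; lia.
Qed.

Hypothesis kE : k = ((3 * D - a) %/ 2 + 8 * a) - 1.

Lemma legal_exists c M e x : state_inv c M e -> c x = None ->
  exists b, legal c x b.
Proof.
move=> inv cx; suff : 0 < #|~: forbidden c x|.
  by case/card_gt0P => b; rewrite inE => ok; exists b; split.
have := cardsC (forbidden c x); rewrite card_ord.
case: (boolP (top x)) => tx.
  by have := card_forbidden_top inv cx tx; lia.
by have := card_forbidden_down inv cx tx; lia.
Qed.

(* A color occurring in [down_son (father x)] is absent from [outs (father x)],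
   so it is forbidden for [x] only because of arcs around [son x]. *)
Lemma reuse_or_few c M e x : state_inv c M e -> c x = None -> ~~ top x ->
  (exists2 b, b \in colors c (down_son (father x)) & legal c x b)
  \/ #|colors c (down_son (father x))| <= (6 * a).-1.
Proof.
move=> inv cx dx; have [pc _ _] := inv.
have [/subsetPn [b bC ok]|sub] :=
    boolP (~~ (colors c (down_son (father x)) \subset forbidden c x)).
  by left; exists b => //; split.
right; apply: leq_trans (card_colors_around inv cx); apply: subset_leq_card.
apply/subsetP => b bC; have := subsetP (negbNE sub) _ bC.
rewrite !inE => /existsP [y /and3P [yx xy cy]].
apply/existsP; exists y; rewrite cy andbT; apply: around.
move: xy; rewrite /clash (down_tl dx) (down_hd dx).
case/or3P => [|yf|]; try by rewrite eq_sym => ->; rewrite ?orbT.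
move: bC; rewrite inE => /existsP [z /andP []]; rewrite inE => /andP [dz zf] /eqP cz.
have zy : clash z y by rewrite /clash (down_hd dz) (eqP zf) yf orbT.
have yz : y != z.
  apply: contraTneq yf => ->; rewrite (down_tl dz) -(eqP zf) eq_sym.
  exact: son_neq_father.
by have := pc z y b yz zy cz (eqP cy).
Qed.

(** * Alice's walk towards the fathers *)

(** Top arcs come first, so that each touching or coloring counts for the quota of [top_father v]
    until that quota is void. *)
Definition next_arc c v x := [/\ son x = v, c x = None &
  top x || (top_father v \subset colored c)].

Lemma next_arc_exists c v : ~~ (father_arcs v \subset colored c) ->
  exists x, next_arc c v x.
Proof.
case/subsetPn => x; rewrite !inE => /eqP xv; rewrite negbK => /eqP cx.
case: (boolP (top_father v \subset colored c)) => [fin|/subsetPn [y]].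
  by exists x; split=> //; rewrite fin orbT.
by rewrite !inE => /andP [ty /eqP yv]; rewrite negbK => /eqP cy; exists y; split; rewrite ?ty.
Qed.

(** An unfinished vertex has at most [4 * a] colored son arcs, too few for the debt to matter. *)
Lemma few_colors_unfinished c M e e' x : state_inv c M e -> c x = None ->
  few_colors c e' (son x).
Proof.
move=> inv cx; apply: few_colors_small.
apply: leq_trans (card_colors_colored _ _) _.
have [le _] := unfinished inv cx.
suff : #|colored c :&: down_son (son x)| <= #|colored c :&: son_arcs (son x)|.
  by lia.
by apply/subset_leq_card/setIS/subsetP => y; rewrite !inE => /andP [].
Qed.

(** Touching [x] pays the debt of [v] and moves it to [father x], of which [x] is a son arc. *)
Lemma touch_arc c M v x : state_inv c M (pred1 v) -> next_arc c v x ->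
  x \notin M -> state_inv c (x |: M) (pred1 (father x)).
Proof.
move=> inv [xv cx topx] xM; have [pc KM Hv] := inv.
split=> //; first by apply: subset_trans KM (subsetUr _ _).
have keep n : n = 0 + n by [].
have sf := negPf (son_neq_father x).
have fs : (father x == son x) = false by rewrite eq_sym.
move=> w; have [q1 q2 f] := Hv w.
have xS : (x \in son_arcs w) = (father x == w) by rewrite inE.
have xU : (x \in father_arcs w) = (son x == w) by rewrite inE.
have xT : (x \in top_father w) = top x && (son x == w) by rewrite inE.
rewrite /= in q1 q2 f *; subst v.
have [wv|wv] := eqVneq w (son x).
  subst w; rewrite ?eqxx ?sf ?fs /= in xS xU xT q1 q2 f *; split.
  (* A down arc is taken only once the quota of the top arcs is void. *)
  - case/orP: topx => [tx|]; last exact: quota_done.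
    apply: quota_step (card_setU1I _ _ _) (card_setU1I _ _ _) (keep _) _ _ q1 => //.
    by rewrite xS xT tx xM.
  - apply: quota_step (card_setU1I _ _ _) (card_setU1I _ _ _) (keep _) _ _ q2 => //.
    by rewrite xS xU xM.
  - exact: few_colors_unfinished inv cx.
rewrite (negPf wv) in q1 q2 f; split.
- apply: quota_step (card_setU1I _ _ _) (card_setU1I _ _ _) (keep _) _ _ q1 => //.
  by rewrite xS xM andbT !addn0 [w == _]eq_sym leq_addl.
- apply: quota_step (card_setU1I _ _ _) (card_setU1I _ _ _) (keep _) _ _ q2 => //.
  by rewrite xS xM andbT !addn0 [w == _]eq_sym leq_addl.
by apply: leq_trans f _; rewrite leq_add2l; case: (w == _) => //=; apply: leq_b1.
Qed.

(** No arc is newly touched, and coloring [x] pays the debt of [v]. The last premise protects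
    [few_colors] at [father x], where [x] lies in [down_son] unless it is top. *)
Lemma color_touched c M v x b : state_inv c M (pred1 v) -> next_arc c v x ->
  x \in M -> legal c x b ->
  [|| top x, b \in colors c (down_son (father x))
    | #|colors c (down_son (father x))| <= (6 * a).-1] ->
  state_inv (color c x b) M pred0.
Proof.
move=> inv [xv cx topx] xM ok reuse; have [pc KM Hv] := inv.
split; first exact: proper_color.
  by rewrite colored_color subUset sub1set xM.
have keep n : n = 0 + n by [].
have sf := negPf (son_neq_father x).
have fs : (father x == son x) = false by rewrite eq_sym.
move=> w; have [q1 q2 f] := Hv w.
have xU : (x \in father_arcs w) = (son x == w) by rewrite inE.
have xT : (x \in top_father w) = top x && (son x == w) by rewrite inE.
have xB : (x \in down_son w) = ~~ top x && (father x == w) by rewrite inE.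
have nK := uncolored cx.
rewrite /= in q1 q2 f *; subst v.
have [wv|wv] := eqVneq w (son x).
  subst w; rewrite ?eqxx ?fs ?andbF /= in xU xT xB q1 q2 f *.
  split.
  - case/orP: topx => [tx|fin]; last first.
      by apply: quota_done; rewrite colored_color (subset_trans fin) ?subsetUr.
    rewrite colored_color.
    apply: quota_step (keep _) (keep _) (card_setU1I _ _ _) (subsetUr _ _) _ q1.
    by rewrite xT tx nK.
  - rewrite colored_color.
    apply: quota_step (keep _) (keep _) (card_setU1I _ _ _) (subsetUr _ _) _ q2.
    by rewrite xU nK.
  - by apply: few_colors_notin; rewrite ?xB //; apply: few_colors_unfinished inv cx.
rewrite (negPf wv) in q1 q2 f; split.
- rewrite colored_color.
  exact: quota_step (keep _) (keep _) (card_setU1I _ _ _) (subsetUr _ _) _ q1.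
- rewrite colored_color.
  exact: quota_step (keep _) (keep _) (card_setU1I _ _ _) (subsetUr _ _) _ q2.
case: (boolP (x \in down_son w)) => xw; last exact: few_colors_notin.
move: xB; rewrite xw => /esym /andP [dx /eqP fx]; subst w.
move: reuse; rewrite (negPf dx) /= => /orP [bC|few]; first exact: few_colors_reuse f.
(* One color beyond [6 * a - 1] still fits the constant of [few_colors]. *)
apply: few_colors_small; rewrite colors_color // xw cardsU1.
apply: leq_trans (_ : (6 * a).-1.+1 <= _); last by rewrite prednK ?muln_gt0.
exact: leq_add (leq_b1 _) few.
Qed.

(** Both quotas of [v] are void, and the repeated color pays the debt in [few_colors]. *)
Lemma color_reuse c M v x b : state_inv c M (pred1 v) ->
  father_arcs v \subset colored c -> x \in down_son v -> legal c x b ->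
  b \in colors c (down_son v) -> state_inv (color c x b) (x |: M) pred0.
Proof.
move=> [pc KM Hv] fin xv ok bC; have [cx _] := ok.
split; first exact: proper_color.
  by rewrite colored_color setUS.
move: (xv); rewrite inE => /andP [dx /eqP fx].
move=> w; have [q1 q2 f] := Hv w.
have xS : (x \in son_arcs w) = (father x == w) by rewrite inE.
have finT : top_father v \subset colored c.
  by apply: subset_trans fin; apply/subsetP => y; rewrite !inE => /andP [].
rewrite /= in q1 q2 f *.
have [wv|wv] := eqVneq w v.
  subst w; split.
  - by apply: quota_done; rewrite colored_color (subset_trans finT) ?subsetUr.
  - by apply: quota_done; rewrite colored_color (subset_trans fin) ?subsetUr.
  - exact: few_colors_reuse f.
rewrite (negPf wv) in q1 q2 f; rewrite fx eq_sym (negPf wv) in xS.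
split.
- rewrite colored_color.
  apply: quota_step (card_setU1I _ _ _) (card_setU1I _ _ _) (card_setU1I _ _ _)
    (subsetUr _ _) _ q1.
  by rewrite xS.
- rewrite colored_color.
  apply: quota_step (card_setU1I _ _ _) (card_setU1I _ _ _) (card_setU1I _ _ _)
    (subsetUr _ _) _ q2.
  by rewrite xS.
by apply: few_colors_notin => //; rewrite inE fx eq_sym (negPf wv) andbF.
Qed.

Lemma settle_finished c M v : state_inv c M (pred1 v) ->
  father_arcs v \subset colored c ->
  (down_son v \subset colored c) || (#|colors c (down_son v)| <= (6 * a).-1) ->
  state_inv c M pred0.
Proof.
move=> [pc KM Hv] fin few; split=> // w; have [q1 q2 f] := Hv w.
have finT : top_father v \subset colored c.
  by apply: subset_trans fin; apply/subsetP => y; rewrite !inE => /andP [].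
rewrite /= in q1 q2 f *.
have [wv|wv] := eqVneq w v; last by rewrite (negPf wv) in q1 q2 f.
subst w; split; try exact: quota_done.
(* If [down_son v] is full, the subset term of [few_colors] replaces the debt. *)
case/orP: few => [full|few]; first by move: f; rewrite /few_colors full !orbT.
by apply: few_colors_small; lia.
Qed.

(* Alice walks towards the fathers, touching arcs, until she meets an arc that
   was already touched, which she colors, or a vertex whose father arcs are
   all colored. *)
Lemma alice_move c M v : state_inv c M (pred1 v) -> (exists y, c y = None) ->
  exists x b M', legal c x b /\ state_inv (color c x b) M' pred0.
Proof.
(* The walk ends because each further step touches a new arc: induction on the untouched arcs. *)
move=> + [y cy]; have [n] := ubnP #|~: M|; elim: n => // n IH in M v * => ltn inv.
have walk w : state_inv c M (pred1 w) -> ~~ (father_arcs w \subset colored c) ->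
    exists x b M', legal c x b /\ state_inv (color c x b) M' pred0.
  move=> invw /next_arc_exists [x nx]; have [xw cx topx] := nx.
  have [xM|xM] := boolP (x \in M); last first.
    apply: IH (touch_arc invw nx xM).
    have : ~: (x |: M) = (~: M) :\ x by apply/setP => z; rewrite !inE negb_or.
    by move=> ->; move: ltn; rewrite (cardsD1 x (~: M)) inE xM.
  have [b0 ok0] := legal_exists invw cx.
  have [tx|dx] := boolP (top x).
    by exists x, b0, M; split=> //; apply: color_touched nx _ _ _ => //; rewrite tx.
  case: (reuse_or_few invw cx dx) => [[b bC ok]|few].
    by exists x, b, M; split=> //; apply: color_touched nx _ _ _; rewrite // bC orbT.
  by exists x, b0, M; split=> //; apply: color_touched nx _ _ _; rewrite // few !orbT.
have [fin|] := boolP (father_arcs v \subset colored c); last exact: walk.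
(* The debt may vanish before Alice has colored anything. She then starts a walk at the son of any
   uncolored arc, as if there were a debt. *)
have restart : state_inv c M pred0 ->
    exists x b M', legal c x b /\ state_inv (color c x b) M' pred0.
  move=> inv0; apply: (walk (son y)); first by apply: state_inv_weaken inv0.
  by apply/subsetPn; exists y; rewrite ?uncolored // inE.
have [full|] := boolP (down_son v \subset colored c).
  by apply: restart; apply: settle_finished fin _; rewrite ?full.
case/subsetPn => x xv; rewrite inE negbK => /eqP cx.
move: (xv); rewrite inE => /andP [dx /eqP fx].
have := reuse_or_few inv cx dx; rewrite fx => - [[b bC ok]|few].
  by exists x, b, (x |: M); split=> //; apply: color_reuse bC.
by apply: restart; apply: settle_finished fin _; rewrite ?few ?orbT.
Qed.

End Strategy.

(** * Incidences as arcs *)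

Section Incidences.
Variables (V : finType) (adj : rel V).
Hypotheses (adj_sym : symmetric adj) (adj_irr : irreflexive adj).

Local Notation arc := (incidence adj).

Definition source (x : arc) : V := (val x).1.
(** The other end must be picked from the edge; by [arcP] the default is never taken. *)
Definition target (x : arc) : V :=
  odflt (source x) [pick w | adj (source x) w && ((val x).2 == [set source x; w])].

Lemma adj_neq u v : adj u v -> u != v.
Proof. by apply: contraTneq => ->; rewrite adj_irr. Qed.

Lemma arcP (x : arc) : adj (source x) (target x) /\ (val x).2 = [set source x; target x].
Proof.
rewrite /target; case: pickP => [w /andP [? /eqP]//|none].
by case/existsP: (valP x) => w; rewrite -/(source x) none.
Qed.

Lemma source_neq_target x : source x != target x.
Proof. by case: (arcP x) => /adj_neq. Qed.

Lemma set2_inj_r (u v w : V) : [set u; v] = [set u; w] -> v = w.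
Proof.
move=> E; have: v \in [set u; w] by rewrite -E set22.
rewrite !inE => /orP [/eqP vu|/eqP//].
have: w \in [set u; v] by rewrite E set22.
by rewrite !inE vu orbb => /eqP.
Qed.

Lemma arc_inj x y : source x = source y -> target x = target y -> x = y.
Proof.
have [_ ex] := arcP x; have [_ ey] := arcP y => txy hxy.
apply: val_inj; rewrite [val x]surjective_pairing [val y]surjective_pairing.
by rewrite ex ey hxy -/(source x) -/(source y) txy.
Qed.

Lemma arc_exists u v : adj u v -> exists x : arc, source x = u /\ target x = v.
Proof.
move=> uv; have i : incidenceb adj (u, [set u; v]).
  by apply/existsP; exists v; rewrite uv eqxx.
pose x : arc := exist _ (u, [set u; v]) i; exists x; split=> //.
by have [_ /= /esym] := arcP x; apply: set2_inj_r.
Qed.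

(** Equal edges need no clause in [clash]: with distinct tails they give opposite arcs, which are
    consecutive. *)
Lemma inc_adjE (x y : arc) : inc_adj (val x) (val y) = clash source target x y.
Proof.
rewrite /inc_adj /clash -/(source x) -/(source y).
have [_ ->] := arcP x; have [_ ->] := arcP y.
have [//|txy /=] := eqVneq (source x) (source y).
have -> : ([set source x; source y] == [set source x; target x]) = (target x == source y).
  by apply/eqP/eqP => [/set2_inj_r ->|->].
have -> : ([set source x; source y] == [set source y; target y]) = (source x == target y).
  by apply/eqP/eqP => [|->]; rewrite setUC // => /set2_inj_r.
case: eqP => //= E; have := set21 (source x) (target x).
by rewrite E !inE (negPf txy) /= => ->; rewrite orbT.
Qed.

Lemma card_out_arcs v : #|outs source v| <= max_degree adj.
Proof.
apply: leq_trans (leq_bigmax v).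
rewrite -(card_in_imset (f := target) (D := outs source v)).
  apply: subset_leq_card; apply/subsetP => w /imsetP [x]; rewrite !inE.
  by move=> /eqP <- ->; case: (arcP x).
by move=> x y; rewrite !inE => /eqP tx /eqP ty; apply: arc_inj; rewrite tx ty.
Qed.

Lemma card_in_arcs v : #|ins target v| <= max_degree adj.
Proof.
apply: leq_trans (leq_bigmax v).
rewrite -(card_in_imset (f := source) (D := ins target v)).
  apply: subset_leq_card; apply/subsetP => w /imsetP [x]; rewrite !inE.
  by move=> /eqP <- ->; rewrite adj_sym; case: (arcP x).
by move=> x y; rewrite !inE => /eqP hx /eqP hy txy; apply: arc_inj; rewrite // hx hy.
Qed.

Section Orientation.
Variables (up : rel V) (a : nat).
Hypothesis up_anti : forall u v, adj u v -> up u v = ~~ up v u.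
Hypothesis card_up : forall v, #|[set w | up v w]| <= a.

(* [up u v] makes v a father of u. *)
Definition is_top x := ~~ up (source x) (target x).

Lemma card_top_arcs v : #|top_father source target is_top v| <= a.
Proof.
apply: leq_trans (card_up v).
rewrite -(card_in_imset (f := source) (D := top_father source target is_top v)).
  apply: subset_leq_card; apply/subsetP => w /imsetP [x]; rewrite !inE /son.
  move=> /andP [tx]; rewrite tx => /eqP <- ->.
  by rewrite up_anti // adj_sym; case: (arcP x).
move=> x y; rewrite !inE /son => /andP [->] /eqP hx /andP [->] /eqP hy txy.
by apply: arc_inj; rewrite // hx hy.
Qed.

Lemma card_down_arcs v : #|down_father source target is_top v| <= a.
Proof.
apply: leq_trans (card_up v).
rewrite -(card_in_imset (f := target) (D := down_father source target is_top v)).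
  apply: subset_leq_card; apply/subsetP => w /imsetP [x]; rewrite !inE /son.
  by case/andP=> ntx; rewrite (negPf ntx) => /eqP <- ->; apply: negbNE.
move=> x y; rewrite !inE /son => /andP [/negPf ->] /eqP tx /andP [/negPf ->] /eqP ty.
by apply: arc_inj; rewrite tx ty.
Qed.

Lemma reverse_arc x : is_top x ->
  exists2 y,
    y \in down_father source target is_top (son source target is_top x)
    & y \in down_son source target is_top (father source target is_top x).
Proof.
move=> tx; have [adjx _] := arcP x.
have [y [ty hy]] : exists y : arc, source y = target x /\ target y = source x.
  by apply: arc_exists; rewrite adj_sym.
have ny : ~~ is_top y by rewrite /is_top ty hy negbK up_anti // adj_sym.
by exists y; rewrite !inE ny /son /father tx (negPf ny) ?ty ?hy eqxx.
Qed.

(** * From the invariant to a win for Alice *)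

Variable k : nat.
Hypothesis a_gt0 : 0 < a.
Hypothesis kE : k = ((3 * max_degree adj - a) %/ 2 + 8 * a) - 1.

Notation inv := (state_inv source target is_top a).

Lemma legal_moveP (c : state adj k) x b : legal_move c x b <-> legal source target c x b.
Proof.
split=> - [cx ok]; split=> //.
  rewrite inE; apply/existsP => - [y /and3P [yx xy /eqP]].
  by apply: ok; rewrite ?inc_adjE.
move=> y yx; rewrite inc_adjE => xy /eqP cy.
by move: ok; rewrite inE => /existsP []; exists y; rewrite yx xy.
Qed.

Lemma not_stuck (c : state adj k) M e : inv c M e -> ~ stuck c.
Proof.
move=> invc [x [cx no]].
have [b ok] := legal_exists card_out_arcs card_in_arcs card_top_arcs
  card_down_arcs reverse_arc a_gt0 kE invc cx.
exact: no b (proj2 (legal_moveP c x b) ok).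
Qed.

Lemma all_coloredP (c : state adj k) : all_colored c \/ exists y, c y = None.
Proof.
have [/forallP all|] := boolP [forall x, c x != None].
  by left => x; apply/eqP.
by rewrite negb_forall => /existsP [y]; rewrite negbK => /eqP cy; right; exists y.
Qed.

Lemma alice_reply (c : state adj k) M v :
  inv c M (pred1 v) -> (exists y, c y = None) ->
  exists x b M', legal_move c x b /\ inv (play c x b) M' pred0.
Proof.
move=> invc some; have [x [b [M' [ok inv']]]] := alice_move source_neq_target
  card_out_arcs card_in_arcs card_top_arcs card_down_arcs reverse_arc a_gt0 kE
  invc some.
exists x, b, M'; split; last exact: inv'.
exact: proj2 (legal_moveP c x b) ok.
Qed.

Lemma card_uncolored_play (c : state adj k) x b : c x = None ->
  #|~: colored (play c x b)| < #|~: colored c|.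
Proof.
move=> cx; rewrite colored_color; apply: proper_card; rewrite properE.
by rewrite setCS subsetUr; apply/subsetPn; exists x; rewrite !inE ?cx ?eqxx.
Qed.

(** Each round, Bob's arc creates a debt at its father and Alice's reply clears it; induction on the
    uncolored arcs. *)
Lemma alice_wins_inv (c : state adj k) M : inv c M pred0 -> alice_wins false c.
Proof.
have [n] := ubnP #|~: colored c|; elim: n => // n IH in c M * => ltn invc.
have [?|_] := all_coloredP c; first exact: AW_done.
apply: AW_bob (not_stuck invc) _ => x b ok.
have invb : inv (play c x b) (x |: M) (pred1 (father source target is_top x)).
  exact: bob_move invc (proj1 (legal_moveP c x b) ok).
have [?|some] := all_coloredP (play c x b); first exact: AW_done.
have [y [d [M' [ok' inv']]]] := alice_reply invb some.
apply: (AW_alice (not_stuck invb) ok'); apply: (IH _ M') => //.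
apply: leq_trans (card_uncolored_play d (proj1 ok')) _.
exact: leq_trans (ltnW (card_uncolored_play b (proj1 ok))) _.
Qed.

Lemma oriented_alice_wins : alice_wins_game adj k.
Proof.
have [?|some] := all_coloredP (empty_state adj k); first exact: AW_done.
have [v _] : exists v : V, True by case: some => y _; exists (source y).
have inv0 : inv (empty_state adj k) set0 pred0 := state_inv_empty _ _ _ _ _.
(* Alice's first move is treated as a reply to a fictitious debt at [v]. *)
have invv : inv (empty_state adj k) set0 (pred1 v) by apply: state_inv_weaken inv0.
have [x [b [M [ok inv']]]] := alice_reply invv some.
exact: AW_alice (not_stuck invv) ok (alice_wins_inv inv').
Qed.

End Orientation.
End Incidences.

(* i_g(G) <= floor((3 Delta - a)/2) + 8 a - 1, stated as: Alice wins the
   incidence coloring game with some number k of colors bounded by the RHS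
   (equivalent to the minimum i_g(G) being <= RHS). *)
Theorem theorem2 (V : finType) (adj : rel V)
  (adj_sym : symmetric adj) (adj_irr : irreflexive adj)
  (a : nat) (Ha : arboricity adj a) :
  exists2 k : nat,
    k <= ((3 * max_degree adj - a) %/ 2 + 8 * a) - 1
    & alice_wins_game adj k.
Proof.
have [dec _] := Ha.
have [up up_anti card_up] := forest_orientation adj_sym adj_irr dec.
have [a0|a_gt0] := posnP a; last first.
  exists (((3 * max_degree adj - a) %/ 2 + 8 * a) - 1) => //.
  exact: (oriented_alice_wins adj_sym adj_irr up_anti card_up a_gt0 erefl).
(* With [a = 0] no vertex has a father, so there is no edge and nothing to color. *)
exists 0 => //; apply: AW_done => x _.
have [adjx _] := arcP x; have := up_anti _ _ adjx.
have up0 u v : up u v = false.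
  have := card_up u; rewrite a0 leqn0 cards_eq0 => /eqP /setP /(_ v).
  by rewrite !inE.
by rewrite !up0.
Qed.
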